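(* Let $W$ be a bounded linear operator on $\mathcal H=l^2(\mathbb N_0,\mu)$ and let $\chi=\{X_n\}_{n=0}^p$ and $\kappa=\{Y_k\}_{k=0}^q$ be arbitrary partitions of $\mathbb N_0$. Then $$\|W\|_\mu^2=\sum_{n=0}^p\sum_{k=0}^q\|\widehat{\mathbf 1}_{X_n}W\widehat{\mathbf 1}_{Y_k}\|_\mu^2 .$$
   Context: Let $\mathbb N_0=\{0,1,\dots\}$ and let $\mu_j>0$ ($j\in\mathbb N_0$) satisfy $\sum_j\mu_j=1$; for $X\subset\mathbb N_0$ put $\mu(X)=\sum_{j\in X}\mu_j$. $\mathcal H=l^2(\mathbb N_0,\mu)$ is the Hilbert space of complex sequences with $\langle x,y\rangle=\sum_j\mu_jx_j\overline{y_j}$ and $\|x\|=\sqrt{\langle x,x\rangle}$; $\|W\|$ is the operator norm of a bounded operator $W$ on $\mathcal H$. For $X\subset\mathbb N_0$, $\widehat{\mathbf 1}_X$ is the operator of multiplication by the indicator of $X$. A partition of $\mathbb N_0$ is a finite collection $\chi=\{Y_0,\dots,Y_J\}$ of pairwise disjoint subsets with union $\mathbb N_0$. Put $\mathcal M_\chi(W)=\sum_{j=0}^J\mu(Y_j)\|W\widehat{\mathbf 1}_{Y_j}\|^2$. The $\mu$-norm of $W$ is $\|W\|_\mu=\inf_\chi\sqrt{\mathcal M_\chi(W)}$, the infimum being over all partitions. *)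

(* Defs.v *)
From HB Require Import structures.
From mathcomp Require Import all_boot all_order all_algebra.
From mathcomp Require Import complex.
From mathcomp Require Import all_classical all_reals all_analysis.
From mathcomp Require Import ring.

Set Implicit Arguments.
Unset Strict Implicit.
Unset Printing Implicit Defensive.

Import Order.TTheory GRing.Theory Num.Theory.
Import numFieldNormedType.Exports.
Import ComplexField.Normc.

Local Open Scope classical_set_scope.
Local Open Scope complex_scope.
Local Open Scope ring_scope.

Record weights (R : realType) := Weights {
  weight :> nat -> R;
  weight_gt0 : forall j, 0 < weight j;
  weight_sum1 : series weight @ \oo --> (1 : R) }.

Lemma weight_ge0 (R : realType) (mu : weights R) j : 0 <= mu j.
Proof. exact/ltW/weight_gt0. Qed.

Lemma normc_ge0 (R : rcfType) (z : R[i]) : 0 <= normc z.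
Proof. by case: z => a b; exact: sqrtr_ge0. Qed.

Section Weighted_l2.
Context {R : realType} (mu : weights R).

Definition meas (X : set nat) : R := limn (series (fun j => mu j * \1_X j)).

Definition sqr_summable : {pred nat -> R[i]} :=
  fun x => `[< cvgn (series (fun j => mu j * normc (x j) ^+ 2)) >].

Lemma sqr_summable_le (x y : nat -> R[i]) :
  (forall j, normc (x j) <= normc (y j)) ->
  y \in sqr_summable -> x \in sqr_summable.
Proof.
move=> xy /asboolP cy; apply/asboolP; apply: series_le_cvg cy => j.
- by rewrite mulr_ge0 ?sqr_ge0 ?weight_ge0.
- by rewrite mulr_ge0 ?sqr_ge0 ?weight_ge0.
- by rewrite ler_wpM2l ?weight_ge0// lerXn2r ?nnegrE ?xy ?normc_ge0.
Qed.

Lemma sqr_summable_submod : submod_closed sqr_summable.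
Proof.
split.
  apply/asboolP; have -> : (fun j => mu j * normc ((0 : nat -> R[i]) j) ^+ 2) =
      0 *: (mu : nat -> R).
    apply/funext => j; rewrite -[RHS]/(0 * mu j) -[(0 : nat -> R[i]) j]/0.
    by rewrite normc0 expr0n mulr0 mul0r.
  by apply: is_cvg_seriesZ; exact/cvgP/weight_sum1.
move=> a x y /asboolP cx /asboolP cy; apply/asboolP.
have c2 := is_cvg_seriesD (@is_cvg_seriesZ _ _ (2 * normc a ^+ 2) cx)
                          (@is_cvg_seriesZ _ _ 2 cy).
apply: series_le_cvg c2 => j /=.
- by rewrite mulr_ge0 ?sqr_ge0 ?weight_ge0.
- change (0 <= (2 * normc a ^+ 2) * (mu j * normc (x j) ^+ 2) +
    2 * (mu j * normc (y j) ^+ 2)).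
  have n0 z : 0 <= mu j * normc z ^+ 2 by rewrite mulr_ge0 ?sqr_ge0 ?weight_ge0.
  apply: addr_ge0; apply: mulr_ge0 => //.
  by apply: mulr_ge0 => //; exact: sqr_ge0.
have H : normc ((a *: x + y) j) <= normc a * normc (x j) + normc (y j).
  by rewrite -normcM; exact: (le_normcD (a * x j : R[i]) (y j)).
apply: (@le_trans _ _ (mu j * (normc a * normc (x j) + normc (y j)) ^+ 2)).
  by rewrite ler_wpM2l ?weight_ge0// lerXn2r ?nnegrE ?addr_ge0 ?mulr_ge0 ?normc_ge0.
have ineq (p q r m : R) : 0 <= m ->
    m * (p * q + r) ^+ 2 <= (2 * p ^+ 2) * (m * q ^+ 2) + 2 * (m * r ^+ 2).
  move=> m0; rewrite -subr_ge0.
  suff -> : (2 * p ^+ 2) * (m * q ^+ 2) + 2 * (m * r ^+ 2) -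
    m * (p * q + r) ^+ 2 = m * (p * q - r) ^+ 2 by rewrite mulr_ge0 ?sqr_ge0.
  by ring.
exact/ineq/weight_ge0.
Qed.

HB.instance Definition _ :=
  GRing.isSubmodClosed.Build R[i] (nat -> R[i]) sqr_summable sqr_summable_submod.

Record l2 := L2 { l2val :> nat -> R[i]; l2valP : l2val \in sqr_summable }.

HB.instance Definition _ := [isSub for l2val].
HB.instance Definition _ := [Choice of l2 by <:].
HB.instance Definition _ := [SubChoice_isSubLmodule of l2 by <:].

(* [R[i]^o] selects the usual topology of the complex field for the limit. *)
Definition inner (x y : l2) : R[i] :=
  limn (series (fun j => (mu j)%:C * x j * (y j)^* : R[i]^o)).

Definition l2norm (x : l2) : R := Num.sqrt (complex.Re (inner x x)).

Lemma inner_self (x : l2) :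
  inner x x = (limn (series (fun j => mu j * normc (x j) ^+ 2)))%:C.
Proof.
have /asboolP cx := l2valP x; apply: (@cvg_lim R[i]^o); first exact: norm_hausdorff.
have E : series (fun j => (mu j)%:C * x j * (x j)^* : R[i]^o) =
    (fun n => (series (fun j => mu j * normc (x j) ^+ 2) n)%:C).
  apply/funext => n; rewrite /series/= rmorph_sum; apply: eq_bigr => j _.
  rewrite rmorphM -mulrA; congr (_ * _).
  by rewrite -sqr_normc -rmorphXn.
rewrite {}E; apply/cvgrPdist_lt => e e0.
have eR : (complex.Re e)%:C = e by rewrite RRe_real// gtr0_real.
have e0' : 0 < complex.Re e by rewrite -ltcR eR.
move/cvgrPdist_lt : (cx) => /(_ _ e0'); apply: filterS => n.
rewrite -rmorphB -ltcR eR; congr (_ < _).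
by rewrite normc_def/= expr0n/= addr0 sqrtr_sqr.
Qed.

Lemma l2norm_sqr (x : l2) :
  l2norm x ^+ 2 = limn (series (fun j => mu j * normc (x j) ^+ 2)).
Proof.
have /asboolP cx := l2valP x.
rewrite /l2norm inner_self sqr_sqrtr//=; apply: limr_ge => //.
near=> n; apply: sumr_ge0 => j _.
by rewrite mulr_ge0 ?sqr_ge0 ?weight_ge0.
Unshelve. all: by end_near. Qed.

Lemma indic_mul_summable (X : set nat) (x : l2) :
  (fun j => \1_X j * x j) \in sqr_summable.
Proof.
apply: sqr_summable_le (l2valP x) => j; rewrite normcM indicE.
by case: (_ \in _); rewrite ?normc1 ?mul1r ?normc0 ?mul0r ?normc_ge0.
Qed.

Definition indic_op (X : set nat) (x : l2) : l2 := L2 (indic_mul_summable X x).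

Lemma indic_op_linear (X : set nat) : linear (indic_op X).
Proof.
move=> a x y; apply/val_inj/funext => j /=.
change (\1_X j * (a * x j + y j) = a * (\1_X j * x j) + \1_X j * y j).
by rewrite mulrDr mulrCA.
Qed.

HB.instance Definition _ (X : set nat) :=
  GRing.isLinear.Build R[i] l2 l2 *:%R (indic_op X) (@indic_op_linear X).

(* [l2norm] is not registered as a norm, so the library's [bounded_near] does not apply. *)
Definition bounded_op (W : {linear l2 -> l2}) :=
  exists C : R, forall x, l2norm (W x) <= C * l2norm x.

(* [sup] is 0 on unbounded sets: this is the operator norm of bounded maps only. *)
Definition opnorm (W : {linear l2 -> l2}) : R :=
  sup [set l2norm (W x) | x in [set x | l2norm x <= 1]].

(* A finite partition is an indexed family whose blocks may be empty, so this is
   not classical_sets.partition, which requires nonempty blocks. *)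
Definition is_partition (J : nat) (Y : 'I_J.+1 -> set nat) :=
  trivIset setT Y /\ cover setT Y = setT.

Definition Mpart (J : nat) (Y : 'I_J.+1 -> set nat) (W : {linear l2 -> l2}) : R :=
  \sum_(j < J.+1) meas (Y j) * opnorm (W \o indic_op (Y j)) ^+ 2.

Definition munorm (W : {linear l2 -> l2}) : R :=
  inf [set r | exists (J : nat) (Y : 'I_J.+1 -> set nat),
         is_partition Y /\ r = Num.sqrt (Mpart Y W)].

End Weighted_l2.

(* Main.v *)
(* For an atomic measure the mu-norm is a Hilbert-Schmidt norm: with [e_j] the
   indicator of [{j}], [munorm W ^+ 2] is the sum of the [||W e_j||^2].
   Each [Mpart Y W] dominates this sum, because [||W e_j||^2] is at most
   [mu_j ||W 1_Y||^2] when [j] is in [Y]; the partitions [{0}, ..., {N-1}, [N, oo)]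
   approach it, because [mu [N, oo)] tends to 0. The theorem then follows from
   the Pythagorean identity applied to each [W e_j]. *)

Require Import Defs.
From mathcomp Require Import all_boot all_order all_algebra.
From mathcomp Require Import complex.
From mathcomp Require Import all_classical all_reals all_analysis.

Set Implicit Arguments.
Unset Strict Implicit.
Unset Printing Implicit Defensive.

Import Order.TTheory GRing.Theory Num.Theory.
Import numFieldNormedType.Exports.
Import ComplexField.Normc.

Local Open Scope classical_set_scope.
Local Open Scope ring_scope.

(** * Convergent real series *)

Section Series.
Variable R : realType.

Lemma cvgn_unique (u : R^nat) (a b : R) : u @ \oo --> a -> u @ \oo --> b -> a = b.
Proof. by apply: cvg_unique; exact: norm_hausdorff. Qed.

Lemma cvg_series_ext (u v : R^nat) (a : R) : u =1 v ->
  series u @ \oo --> a -> series v @ \oo --> a.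
Proof. by move=> /funext ->. Qed.

Lemma cvg_series_sum (I : Type) (r : seq I) (u : I -> R^nat) (l : I -> R) :
  (forall i, series (u i) @ \oo --> l i) ->
  series (fun j => \sum_(i <- r) u i j) @ \oo --> \sum_(i <- r) l i.
Proof.
move=> ul; have -> : series (fun j => \sum_(i <- r) u i j) =
    (fun n => \sum_(i <- r) series (u i) n).
  by apply/funext => n; rewrite /series/= exchange_big.
by apply: cvg_big => // x; exact: add_continuous.
Qed.

Lemma cvg_series_scale (c l : R) (u : R^nat) :
  series u @ \oo --> l -> series (fun j => c * u j) @ \oo --> c * l.
Proof.
move=> ul; have -> : series (fun j => c * u j) = (fun n => c * series u n).
  by apply/funext => n; rewrite /series/= mulr_sumr.
exact: cvgMr.
Qed.

Lemma cvg_series1 (k : nat) (a : R) :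
  series (fun j => if j == k then a else 0) @ \oo --> a.
Proof.
apply: cvg_near_cst; near=> n; rewrite /series/= big_mkord.
have kn : (k < n)%N by near: n; exact: nbhs_infty_gt.
rewrite (bigD1 (Ordinal kn))//= eqxx big1 ?addr0// => i /negPf ik.
by rewrite -val_eqE/= in ik; rewrite ik.
Unshelve. all: by end_near. Qed.

Lemma cvg_series_le (u v : R^nat) (a b : R) : (forall j, u j <= v j) ->
  series u @ \oo --> a -> series v @ \oo --> b -> a <= b.
Proof.
move=> uv ua vb; rewrite -(cvg_lim (@norm_hausdorff _ _) ua).
rewrite -(cvg_lim (@norm_hausdorff _ _) vb).
by apply: lim_series_le => //; [exact/cvgP/ua|exact/cvgP/vb].
Qed.

Lemma series_le_lim (u : R^nat) (a : R) n : (forall j, 0 <= u j) ->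
  series u @ \oo --> a -> series u n <= a.
Proof.
move=> u0 ua; rewrite -(cvg_lim (@norm_hausdorff _ _) ua).
apply: nondecreasing_cvgn_le; last exact/cvgP/ua.
by apply/nondecreasing_seqP => m; rewrite /series/= big_nat_recr//= lerDl.
Qed.

End Series.
Arguments cvg_series_ext {R u v a}.
Arguments cvg_series_sum {R I r u l}.
Arguments cvg_series_scale {R} c {l u}.
Arguments cvg_series1 {R}.

Section L2.
Context {R : realType} {mu : weights R}.
Implicit Types (x : l2 mu) (V : {linear l2 mu -> l2 mu}).

(** * Norm and measure as sums of convergent series *)

Lemma l2norm_ge0 x : 0 <= l2norm x. Proof. exact: sqrtr_ge0. Qed.

(** Through this, identities and inequalities between norms reduce to termwise comparisons of
    coordinates. *)
Lemma cvg_l2norm x :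
  series (fun j => mu j * normc (x j) ^+ 2) @ \oo --> l2norm x ^+ 2.
Proof. by rewrite l2norm_sqr; have /asboolP := l2valP x. Qed.
Arguments cvg_l2norm : clear implicits.

Lemma l2normZ a x : l2norm (a *: x) = normc a * l2norm x.
Proof.
apply/eqP; rewrite -(@eqrXn2 _ 2)// ?mulr_ge0 ?l2norm_ge0 ?normc_ge0//.
apply/eqP; apply: cvgn_unique (cvg_l2norm (a *: x)) _.
rewrite exprMn.
apply: cvg_series_ext (cvg_series_scale (normc a ^+ 2) (cvg_l2norm x)) => j.
by rewrite mulrCA -exprMn -normcM.
Qed.

Lemma normc_real (r : R) : 0 <= r -> normc r%:C%C = r.
Proof. by move=> r0; rewrite /= expr0n/= addr0 sqrtr_sqr ger0_norm. Qed.

(** [meas] is a [limn], informative only for a convergent series; domination by the series of [mu]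
    provides the convergence. *)
Lemma cvg_meas (X : set nat) :
  series (fun j => mu j * \1_X j) @ \oo --> meas mu X.
Proof.
apply: (@series_le_cvg R _ mu) => [j|j|j|]; last exact/cvgP/weight_sum1.
- by rewrite mulr_ge0 ?weight_ge0// indicE.
- exact: weight_ge0.
- by rewrite ler_piMr ?weight_ge0// indicE; case: (_ \in _).
Qed.
Arguments cvg_meas : clear implicits.

Lemma meas_ge0 (X : set nat) : 0 <= meas mu X.
Proof.
rewrite -[leLHS](_ : series (fun j => mu j * \1_X j) 0%N = 0); last first.
  by rewrite /series/= big_geq.
apply: series_le_lim (cvg_meas X) => j.
by rewrite mulr_ge0 ?weight_ge0// indicE.
Qed.

Lemma meas1 k : meas mu [set k] = mu k.
Proof.
apply: cvgn_unique (cvg_meas [set k]) _.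
apply: cvg_series_ext (cvg_series1 k (mu k)) => j; rewrite indicE.
have -> : (j \in [set k]) = (j == k) by apply/idP/eqP; rewrite inE.
by case: eqP => [->|]; rewrite ?mulr1 ?mulr0.
Qed.

Lemma l2norm0 : l2norm (0 : l2 mu) = 0.
Proof. by rewrite -(scale0r (0 : l2 mu)) l2normZ normc0 mul0r. Qed.

(** * The operator norm *)

Lemma opnorm_le V C : 0 <= C -> (forall x, l2norm (V x) <= C * l2norm x) ->
  opnorm V <= C.
Proof.
move=> C0 VC; apply: ge_sup => [|_ [x /= x1 <-]].
  by exists (l2norm (V 0)), 0 => //=; rewrite l2norm0.
by apply: le_trans (VC x) _; rewrite ler_piMr.
Qed.

Lemma bounded_opP V : bounded_op V ->
  exists2 C, 0 <= C & forall x, l2norm (V x) <= C * l2norm x.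
Proof.
move=> [C VC]; exists `|C| => // x.
by apply: le_trans (VC x) _; rewrite ler_wpM2r ?l2norm_ge0 ?ler_norm.
Qed.

(** Boundedness ensures that the [sup] in [opnorm] is a true upper bound and not the default value
    0. *)
Lemma opnorm_ge_unit V x : bounded_op V -> l2norm x <= 1 ->
  l2norm (V x) <= opnorm V.
Proof.
move=> /bounded_opP[C C0 VC] x1; apply: sup_upper_bound; last by exists x.
split; first by exists (l2norm (V x)), x.
by exists C => _ [y /= y1 <-]; apply: le_trans (VC y) _; rewrite ler_piMr.
Qed.

Lemma opnorm_ge V x : bounded_op V -> l2norm (V x) <= opnorm V * l2norm x.
Proof.
(* A vector of norm 0 cannot be rescaled to norm 1; there a bounding constant forces [V x] to have
   norm 0. *)
move=> hV; have [x0|x0] := eqVneq (l2norm x) 0.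
  by have [C _ /(_ x)] := bounded_opP hV; rewrite x0 !mulr0.
have xp : 0 < l2norm x by rewrite lt_def x0 l2norm_ge0.
have nV : normc ((l2norm x)^-1)%:C%C = (l2norm x)^-1.
  by rewrite normc_real// invr_ge0 ltW.
rewrite -ler_pdivrMr// mulrC -nV -l2normZ -linearZ.
by apply: opnorm_ge_unit => //; rewrite l2normZ nV mulVf.
Qed.

Lemma opnorm_ge0 V : bounded_op V -> 0 <= opnorm V.
Proof.
move=> hV; apply: le_trans (l2norm_ge0 (V 0)) _.
by apply: opnorm_ge_unit; rewrite ?l2norm0.
Qed.

Lemma l2norm_indic_le (X : set nat) x : l2norm (indic_op X x) <= l2norm x.
Proof.
rewrite -ler_sqr ?nnegrE ?l2norm_ge0//.
apply: cvg_series_le (cvg_l2norm _) (cvg_l2norm _) => j /=.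
rewrite ler_wpM2l ?weight_ge0// normcM indicE.
by case: (_ \in _); rewrite ?normc1 ?mul1r// normc0 mul0r expr0n sqr_ge0.
Qed.

Lemma bounded_op_indicr V X : bounded_op V -> bounded_op (V \o indic_op X).
Proof.
move=> /bounded_opP[C C0 VC]; exists C => x /=.
by apply: le_trans (VC _) _; rewrite ler_wpM2l// l2norm_indic_le.
Qed.

Lemma bounded_op_indicl V X : bounded_op V -> bounded_op (indic_op X \o V).
Proof.
move=> [C VC]; exists C => x /=.
exact: le_trans (l2norm_indic_le _ _) (VC _).
Qed.

(** * Coordinate vectors *)

Lemma delta_summable k :
  (fun j => if j == k then 1 else 0 : R[i]) \in @sqr_summable R mu.
Proof.
apply/asboolP; apply: (cvgP (mu k)); apply: cvg_series_ext (cvg_series1 k (mu k)) => j.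
by case: eqP => [->|]; rewrite ?normc1 ?normc0 ?expr1n ?expr0n ?mulr1 ?mulr0.
Qed.

(** Not normalised: the squared norm is [mu k], so the weights occurring in [Mpart] are absorbed
    into these vectors. *)
Definition delta k : l2 mu := L2 (delta_summable k).

Lemma l2norm_delta k : l2norm (delta k) ^+ 2 = mu k.
Proof.
apply: cvgn_unique (cvg_l2norm _) _; apply: cvg_series_ext (cvg_series1 k (mu k)) => j /=.
by case: eqP => [->|]; rewrite ?normc1 ?normc0 ?expr1n ?expr0n ?mulr1 ?mulr0.
Qed.

Lemma l2norm_delta_gt0 k : 0 < l2norm (delta k).
Proof.
rewrite lt_def l2norm_ge0 andbT -sqrf_eq0 l2norm_delta.
by rewrite gt_eqF// weight_gt0.
Qed.

(** The square of the left side is a single term of the nonnegative series for [l2norm x ^+ 2]. *)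
Lemma normc_coord_le x k : normc (x k) * l2norm (delta k) <= l2norm x.
Proof.
rewrite -ler_sqr ?nnegrE ?mulr_ge0 ?normc_ge0 ?l2norm_ge0// exprMn l2norm_delta.
apply: cvg_series_le (cvg_series1 k _) (cvg_l2norm x) => j.
by case: eqP => [->|_]; [rewrite mulrC|rewrite mulr_ge0 ?sqr_ge0 ?weight_ge0].
Qed.

Lemma indic_op_delta X k : indic_op X (delta k) = (\1_X k : R[i]) *: delta k.
Proof.
apply/val_inj/funext => j /=.
change (\1_X j * (delta k) j = (\1_X k : R[i]) * (delta k) j) => /=.
by case: eqP => [->|]; rewrite ?mulr0.
Qed.

Lemma indic_op1 x k : indic_op [set k] x = x k *: delta k.
Proof.
apply/val_inj/funext => j /=.
change (\1_[set k] j * x j = x k * (delta k) j) => /=.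
rewrite indicE; have -> : (j \in [set k]) = (j == k) by apply/idP/eqP; rewrite inE.
by case: eqP => [->|]; rewrite ?mulr0 ?mul0r ?mul1r ?mulr1.
Qed.

(** The operator has rank at most one: it sends [x] to [x k *: V (delta k)], and [normc_coord_le]
    controls [x k]. *)
Lemma opnorm_indic1 V k :
  opnorm (V \o indic_op [set k]) <= l2norm (V (delta k)) / l2norm (delta k).
Proof.
apply: opnorm_le => [|x /=]; first by rewrite divr_ge0 ?l2norm_ge0.
rewrite indic_op1 linearZ l2normZ mulrC -mulrA ler_wpM2l ?l2norm_ge0//.
by rewrite mulrC ler_pdivlMr ?l2norm_delta_gt0// normc_coord_le.
Qed.

(** * Sums over a partition and the lower bound for [Mpart] *)

Lemma sum_indic (J : nat) (Y : 'I_J.+1 -> set nat) j :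
  is_partition Y -> \sum_(k < J.+1) \1_(Y k) j = 1 :> R.
Proof.
move=> [tY cY]; have [k _ Yk] : cover setT Y j by rewrite cY.
rewrite (bigD1 k)//= indicE mem_set// big1 ?addr0// => i /eqP ik.
rewrite indicE memNset// => Yi; apply: ik.
by apply: tY => //; exists j.
Qed.

Lemma sum_meas (J : nat) (Y : 'I_J.+1 -> set nat) :
  is_partition Y -> \sum_(k < J.+1) meas mu (Y k) = 1.
Proof.
move=> hY; apply: cvgn_unique _ (@weight_sum1 R mu).
apply: cvg_series_ext (cvg_series_sum (fun k => cvg_meas (Y k))) => j.
by rewrite -mulr_sumr sum_indic// mulr1.
Qed.

(** Pythagorean identity: at each coordinate exactly one block contributes. *)
Lemma sum_l2norm_indic (J : nat) (Y : 'I_J.+1 -> set nat) x :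
  is_partition Y -> \sum_(k < J.+1) l2norm (indic_op (Y k) x) ^+ 2 = l2norm x ^+ 2.
Proof.
move=> hY; apply: cvgn_unique _ (cvg_l2norm x).
apply: cvg_series_ext (cvg_series_sum (fun k => cvg_l2norm (indic_op (Y k) x))) => j.
rewrite -[RHS]mul1r -(sum_indic j hY) mulr_suml; apply: eq_bigr => k _ /=.
rewrite normcM exprMn mulrCA !indicE.
by case: (_ \in _); rewrite ?normc1 ?normc0 ?expr1n ?expr0n.
Qed.

(** Only the block containing [j] contributes, and there [indic_op (Y k)] fixes [delta j]. Keeping
    all blocks, with indicators, makes the bound summable over [j]. *)
Lemma l2norm_op_delta_le V (J : nat) (Y : 'I_J.+1 -> set nat) j :
  bounded_op V -> is_partition Y ->
  l2norm (V (delta j)) ^+ 2 <=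
  \sum_(k < J.+1) opnorm (V \o indic_op (Y k)) ^+ 2 * (mu j * \1_(Y k) j).
Proof.
move=> hV hY; rewrite -[leLHS]mul1r -(sum_indic j hY) mulr_suml.
apply: ler_sum => k _; rewrite indicE; case: (boolP (j \in Y k)) => jk; last first.
  by rewrite mul0r !mulr0.
rewrite mul1r mulr1 -l2norm_delta -exprMn.
have hVk := bounded_op_indicr (Y k) hV.
rewrite ler_sqr ?nnegrE ?mulr_ge0 ?opnorm_ge0 ?l2norm_ge0//.
have := opnorm_ge (delta j) hVk.
by rewrite /= indic_op_delta indicE jk scale1r.
Qed.

(** Summing [l2norm_op_delta_le] over [j] turns each [mu j * \1_(Y k) j] into [meas mu (Y k)]. *)
Lemma Mpart_ge V (J : nat) (Y : 'I_J.+1 -> set nat) (s : R) :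
  bounded_op V -> is_partition Y ->
  series (fun j => l2norm (V (delta j)) ^+ 2) @ \oo --> s -> s <= Mpart Y V.
Proof.
move=> hV hY Vs; rewrite /Mpart.
under eq_bigr do rewrite mulrC.
have cY k := cvg_series_scale (opnorm (V \o indic_op (Y k)) ^+ 2) (cvg_meas (Y k)).
apply: cvg_series_le Vs (cvg_series_sum cY) => j.
exact: l2norm_op_delta_le.
Qed.

(** * Partitions into singletons and a tail, and the resulting formula for the mu-norm *)

Definition singletons_tail N (k : 'I_N.+1) : set nat :=
  if (k < N)%N then [set val k] else [set j | (N <= j)%N].

Lemma singletons_tail_partition N : is_partition (@singletons_tail N).
Proof.
(* The block index is a function of the point, which yields disjointness. *)
have val_eq (k : 'I_N.+1) j : singletons_tail k j -> val k = minn j N.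
  rewrite /singletons_tail; case: ltnP => [kN /= ->|Nk /= Nj].
    by rewrite (minn_idPl (ltnW kN)).
  by rewrite (minn_idPr Nj); apply/eqP; rewrite eqn_leq Nk -ltnS ltn_ord.
split.
  move=> i k _ _ [j [/val_eq ij /val_eq kj]].
  by apply/val_inj; rewrite ij kj.
apply/seteqP; split => // j _.
have [jN|Nj] := ltnP j N.
  by exists (Ordinal (ltn_trans jN (ltnSn N))); rewrite /singletons_tail//= jN.
by exists ord_max; rewrite /singletons_tail//= ltnn.
Qed.

(** By [opnorm_indic1] and [l2norm_delta], the singleton of [j] contributes at most
    [l2norm (V (delta j)) ^+ 2]; the tail contributes at most its measure times [C ^+ 2]. *)
Lemma Mpart_singletons_tail V (C : R) N : bounded_op V ->
  0 <= C -> (forall x, l2norm (V x) <= C * l2norm x) ->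
  Mpart (@singletons_tail N) V <=
  series (fun j => l2norm (V (delta j)) ^+ 2) N + (1 - series mu N) * C ^+ 2.
Proof.
move=> hV C0 VC; rewrite /Mpart big_ord_recr/=.
have head_set (k : 'I_N) : singletons_tail (widen_ord (leqnSn N) k) = [set val k].
  by rewrite /singletons_tail/= ltn_ord.
(* The tail carries the mass that the singletons leave from the total 1. *)
have -> : 1 - series mu N = meas mu (singletons_tail (@ord_max N)).
  rewrite -(sum_meas (singletons_tail_partition N)) big_ord_recr/= addrAC.
  rewrite /series/= big_mkord [X in X - _](_ : _ = \sum_(k < N) mu k) ?subrr ?add0r//.
  by apply: eq_bigr => k _; rewrite head_set meas1.
apply: lerD.
  rewrite /series/= big_mkord; apply: ler_sum => k _.
  rewrite head_set meas1 -l2norm_delta -exprMn.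
  have hVk := bounded_op_indicr [set val k] hV.
  rewrite ler_sqr ?nnegrE ?mulr_ge0 ?opnorm_ge0 ?l2norm_ge0// mulrC.
  by rewrite -ler_pdivlMr ?l2norm_delta_gt0// opnorm_indic1.
have hVt := bounded_op_indicr (singletons_tail (@ord_max N)) hV.
rewrite ler_wpM2l ?meas_ge0// ler_sqr ?nnegrE ?opnorm_ge0//.
apply: opnorm_le => // x /=.
by apply: le_trans (VC _) _; rewrite ler_wpM2l// l2norm_indic_le.
Qed.

(** The Hilbert-Schmidt formula. Stated as a convergence, it lets series be added and identified by
    uniqueness of limits. *)
Lemma cvg_munorm V : bounded_op V ->
  series (fun j => l2norm (V (delta j)) ^+ 2) @ \oo --> munorm V ^+ 2.
Proof.
move=> hV; have [C C0 VC] := bounded_opP hV.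
have : cvgn (series (fun j => l2norm (V (delta j)) ^+ 2)).
  (* Since [l2norm (delta j) ^+ 2] is [mu j], the terms are dominated by [C ^+ 2 * mu j]. *)
  have cC := cvg_series_scale (C ^+ 2) (@weight_sum1 R mu).
  apply: series_le_cvg (cvgP _ cC) => j /=.
  - exact: sqr_ge0.
  - by rewrite mulr_ge0 ?sqr_ge0 ?weight_ge0.
  - by rewrite -l2norm_delta -exprMn ler_sqr ?nnegrE ?mulr_ge0 ?l2norm_ge0.
set s := limn _ => Vs; suff -> : munorm V ^+ 2 = s by [].
have s0 : 0 <= s.
  by apply: limr_ge => //; apply: nearW => n; apply: sumr_ge0 => j _; exact: sqr_ge0.
(* The infimum needs a nonempty set; for [N = 0] the tail alone is the trivial partition. *)
have E0 : [set r | exists (J : nat) (Y : 'I_J.+1 -> set nat),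
    is_partition Y /\ r = Num.sqrt (Mpart Y V)] !=set0.
  by eexists; exists 0%N, (@singletons_tail 0); split;
    [exact: singletons_tail_partition|].
have mu0 : 0 <= munorm V.
  by apply: lb_le_inf => // _ [J [Y [_ ->]]]; exact: sqrtr_ge0.
apply/eqP; rewrite eq_le; apply/andP; split; last first.
  (* Lower bound: [Num.sqrt s] lies below every [Num.sqrt (Mpart Y V)], hence below their
     infimum. *)
  rewrite -(sqr_sqrtr s0) ler_sqr ?nnegrE ?sqrtr_ge0//.
  apply: lb_le_inf => // _ [J [Y [hY ->]]].
  by apply: ler_wsqrtr; exact: Mpart_ge.
(* Upper bound: the estimate for singletons and a tail tends to [s], since the mass of the tail
   tends to 0. *)
have c : series (fun j => l2norm (V (delta j)) ^+ 2) N
    + (1 - series mu N) * C ^+ 2 @[N --> \oo] --> s + (1 - 1) * C ^+ 2.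
  apply: cvgD => //; apply: cvgMl; apply: cvgB; first exact: cvg_cst.
  exact: weight_sum1.
rewrite subrr mul0r addr0 in c.
rewrite -(cvg_lim (@norm_hausdorff _ _) c); apply: limr_ge; first exact: cvgP c.
apply: nearW => N; apply: le_trans (Mpart_singletons_tail N hV C0 VC).
have M0 : 0 <= Mpart (@singletons_tail N) V.
  by apply: sumr_ge0 => k _; rewrite mulr_ge0 ?meas_ge0 ?sqr_ge0.
rewrite -[leRHS]sqr_sqrtr// ler_sqr ?nnegrE ?sqrtr_ge0//.
apply: ge_inf.
  by exists 0 => _ [J [Y [_ ->]]]; exact: sqrtr_ge0.
by exists N, (@singletons_tail N); split => //; exact: singletons_tail_partition.
Qed.

End L2.

Theorem lemma2p5 (R : realType) (mu : weights R)
    (W : {linear l2 mu -> l2 mu}) (hW : bounded_op W)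
    (p q : nat) (X : 'I_p.+1 -> set nat) (Y : 'I_q.+1 -> set nat)
    (hX : is_partition X) (hY : is_partition Y) :
  munorm W ^+ 2 =
  \sum_(n < p.+1) \sum_(k < q.+1)
    munorm (indic_op (X n) \o W \o indic_op (Y k)) ^+ 2.
Proof.
have cXY n k := cvg_munorm (bounded_op_indicr (Y k)
  (bounded_op_indicl (X n) hW)).
(* Both sides are sums of series over [j], so it suffices to compare the terms for each
   [delta j]. *)
apply: cvgn_unique (cvg_munorm hW) _.
apply: cvg_series_ext (cvg_series_sum (fun n => cvg_series_sum (cXY n))) => j.
(* Each [indic_op (Y k) (delta j)] is [delta j] or 0, so the sum over [k] keeps one block; the sum
   over [n] is Pythagoras for [W (delta j)]. *)
rewrite exchange_big /= -[RHS]mul1r -(sum_indic j hY) mulr_suml.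
apply: eq_bigr => k _; rewrite -(sum_l2norm_indic _ hX) mulr_sumr.
apply: eq_bigr => n _; rewrite indic_op_delta !indicE.
case: (_ \in _); rewrite ?scale1r ?mul1r// scale0r !linear0 l2norm0.
by rewrite expr0n mul0r.
Qed.
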